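(* Let $a,d,k$ be positive integers with $\gcd(a,d)=1$ and $2\le k\le a$. Let $q$ and $r$ be nonnegative integers with $a-1=q(k-1)+r$ and $0\le r<k-1$, and put $a_k=a+(k-1)d$. Let $\lambda$ be a complex number with $\lambda\ne 0$, $\lambda^{a}\ne 1$ and $\lambda^d\ne 1$. Then for every positive integer $\mu$, $$ \begin{aligned} &s_\mu^{(\lambda)}(a,a+d,\dots,a+(k-1)d)\\ &=\sum_{n=0}^\mu\frac{(-a)^n}{(\lambda^{a}-1)^{n+1}}\binom{\mu}{n}\left(\sum_{j=0}^n\left\langle{n\atop n-j}\right\rangle\lambda^{ja}\right)\\ &\qquad\times\sum_{i=0}^{\mu-n}\left\{{\mu-n\atop i}\right\}\lambda^i\biggl[\frac{\mathrm{d}^i}{\mathrm{d}x^i}\biggl(1+\frac{x^{d}(x^{a_k}-x^{a})}{x^d-1}\cdot\frac{x^{q a_k}-1}{x^{a_k}-1}+\frac{x^{q a_k+a+d}(x^{rd}-1)}{x^d-1}\biggr)\biggr]_{x=\lambda}\\ &\quad+\frac{(-1)^{\mu+1}}{(\lambda-1)^{\mu+1}}\sum_{j=0}^\mu\left\langle{\mu\atop \mu-j}\right\rangle\lambda^j. \end{aligned} $$ Here the quotient $\frac{x^{q a_k}-1}{x^{a_k}-1}$ is understood as the polynomial $\sum_{t=0}^{q-1}x^{t a_k}$.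
   Context: For positive integers $a_1,\dots,a_k$ with $\gcd(a_1,\dots,a_k)=1$, $\mathrm{NR}(a_1,\dots,a_k)$ denotes the (finite) set of positive integers that cannot be written as a nonnegative integer combination of $a_1,\dots,a_k$, and $s_\mu^{(\lambda)}(a_1,\dots,a_k):=\sum_{n\in \mathrm{NR}(a_1,\dots,a_k)}\lambda^n n^\mu$. The Stirling numbers of the second kind are $\left\{{n\atop m}\right\}=\frac{1}{m!}\sum_{i=0}^m(-1)^i\binom{m}{i}(m-i)^n$, with $0^0=1$. The Eulerian numbers are $\left\langle{n\atop m}\right\rangle=\sum_{k=0}^{m}(-1)^k\binom{n+1}{k}(m-k+1)^n$ for $0\le m\le n$; thus $\left\langle{0\atop 0}\right\rangle=1$, $\left\langle{n\atop n}\right\rangle=0$ for $n\ge1$, and $\sum_{k=0}^\infty k^nx^k=\frac{1}{(1-x)^{n+1}}\sum_{m=0}^{n-1}\left\langle{n\atop m}\right\rangle x^{m+1}$ for $n\ge 1$. $\frac{\mathrm{d}^i}{\mathrm{d}x^i}$ denotes the $i$-th derivative with respect to $x$ (unrelated to the integer $d$), and $[\,\cdot\,]_{x=\lambda}$ denotes evaluation at $x=\lambda$. *)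

(* Defs.v *)
From mathcomp Require Import all_boot all_order all_algebra.
From mathcomp Require Import all_classical all_reals all_analysis.
From mathcomp Require Import complex.
Set Implicit Arguments.
Unset Strict Implicit.
Unset Printing Implicit Defensive.
Import Order.TTheory GRing.Theory Num.Theory.
Import numFieldNormedType.Exports.
Local Open Scope classical_set_scope.
Local Open Scope ring_scope.

Definition NR (k : nat) (A : 'I_k -> nat) : set nat :=
  [set n | (0 < n)%N /\ ~ exists c : 'I_k -> nat, n = (\sum_i c i * A i)%N].

(* When the generators are positive with gcd 1, NR A is finite and this
   finite-support sum is the ordinary sum over NR A; if the support were
   infinite it would be 0 by convention. *)
Definition power_sum (R : realType) (k : nat) (A : 'I_k -> nat)
    (lambda : R[i]) (mu : nat) : R[i] :=
  \sum_(n \in NR A) lambda ^+ n * n%:R ^+ mu.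

(* 0 ^ 0 = 1 *)
Definition stirling2 (n m : nat) : rat :=
  (m`!%:R)^-1 *
  \sum_(i < m.+1) (-1) ^+ i * 'C(m, i)%:R * (m - i)%:R ^+ n.

(* Intended for m <= n. *)
Definition eulerian (n m : nat) : int :=
  \sum_(k < m.+1) (-1) ^+ k * 'C(n.+1, k)%:R * ((m - k).+1)%:R ^+ n.

(* Iterated complex derivative; R[i]^o is R[i] as a normed module over itself. *)
Definition cderiven (R : realType) (n : nat) (f : R[i] -> R[i]) : R[i] -> R[i] :=
  derive1n n (f : R[i] -> R[i]^o).

(* Main.v *)
Require Import Defs.
From HB Require Import structures.
From mathcomp Require Import all_boot all_order all_algebra.
From mathcomp Require Import all_classical all_reals all_analysis.
From mathcomp Require Import complex.
From mathcomp Require Import ring zify.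
Import Order.TTheory GRing.Theory Num.Theory.
Import numFieldNormedType.Exports.
Local Open Scope ring_scope.

Set Implicit Arguments.
Unset Strict Implicit.
Unset Printing Implicit Defensive.

(** Why the formula holds.  Write m = k - 1.  The integers s a + j d with
    0 <= j <= s m are exactly the combinations of a, a + d, ..., a + m d, so
    the least combination in the class of j d modulo a (0 <= j < a) is
    w_j = ceil(j / m) a + j d.  Hence a gap is an integer strictly below the
    w_j that is congruent to it ([progression_gapP]), and it remains to sum
    f(n) = lambda^n n^mu over these initial pieces of residue classes.

    If F(n + a) - F(n) = f(n), each piece telescopes, and since the w_j form a
    complete residue system the total is the sum of the F(w_j) minus the sum
    of F(s) for 0 <= s < a ([sum_below_representatives]).  With
    x = lambda^a != 1, such an F is lambda^n G(n) for the polynomial G that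
    solves x G(y + a) - G(y) = y^mu.  The coefficients of G come from a
    moment functional L with x L(p(X + 1)) - L(p) = p(0): put
    G(y) = L((y + a X)^mu).  So only the moments L(X^n) have to be
    identified.  They are values at 0 of solutions for a = 1, and a solution p
    of x p(y + 1) - p(y) = y^n of degree at most n has
    (x - 1)^(n+1) p(0) = (-1)^n E_n(x), with E_n = [eulerian_poly] n:
    expand (x - 1)^(n+1), telescope each x^k p(0) down to p(-k), and use that
    finite differences of order n + 1 kill p ([eulerian_poly_difference],
    [antidiffP]).  The same lemma evaluates the subtracted sum of the F(s): as
    a function of a shift y of its argument it solves the equation with
    lambda for x and 1 for a, whence the last term of the formula
    ([sum_antidiff]).

    In the sum of the F(w_j) there remain the sums of w_j^n lambda^(w_j).  By
    w^n = sum_i S(n, i) w (w - 1) ... (w - i + 1) these are Stirling combinations of lambda^i P^(i)(lambda) for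
    P = sum_j X^(w_j) ([stirling2_derivn_sum]).  Grouping the j in blocks of m
    consecutive values turns P into the bracketed expression wherever
    x^d != 1 ([sum_expr_apery]), in particular near lambda, which is enough
    for all derivatives at lambda ([near_eq_derive1n]). *)

(** * Surjection numbers and finite differences *)

(** This is m! S(n, m), the number of surjections from n points onto m; it
    avoids the division by m! and so makes sense in every commutative ring. *)
Definition surj_count (A : comNzRingType) (n m : nat) : A :=
  \sum_(i < m.+1) (-1) ^+ i * 'C(m, i)%:R * (m - i)%:R ^+ n.

Lemma surj_count0 (A : comNzRingType) m : surj_count A 0 m = (m == 0)%:R.
Proof.
transitivity ((1 - 1 : A) ^+ m); last by rewrite subrr expr0n.
rewrite exprBn; apply: eq_bigr => i _.
by rewrite expr0 !expr1n !mulr1 mulr_natr.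
Qed.

Lemma surj_countS0 (A : comNzRingType) n : surj_count A n.+1 0 = 0.
Proof. by rewrite /surj_count big_ord1 subn0 expr0n mulr0. Qed.

(** Pascal's rule turns the right-hand sum into the alternating sum with the
    binomials of m and the powers of m + 1 - i; absorption,
    (m + 1 - i) C(m + 1, i) = (m + 1) C(m, i), does the same on the left. *)
Lemma surj_countSS (A : comNzRingType) n m :
  surj_count A n.+1 m.+1 = m.+1%:R * (surj_count A n m.+1 + surj_count A n m).
Proof.
have pascal (s u x y : A) : -1 * s * (x + y) * u + s * y * u = -1 * s * x * u by ring.
pose T := \sum_(i < m.+1) (-1) ^+ i * 'C(m, i)%:R * (m.+1 - i)%:R ^+ n : A.
have HT : surj_count A n m.+1 + surj_count A n m = T.
  rewrite /surj_count /T big_ord_recl [\sum_(i < m.+1) _ in RHS]big_ord_recl.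
  rewrite !bin0 -addrA; congr (_ + _).
  rewrite [X in _ + X = _](eq_bigr (fun i : 'I_m.+1 =>
    (-1) ^+ i * 'C(m, i)%:R * (m.+1 - lift ord0 i)%:R ^+ n)); last first.
    by move=> i _; rewrite lift0 subSS.
  rewrite -big_split /= big_ord_recr /= [X in _ + X](_ : _ = 0) ?addr0.
    apply: eq_bigr => i _; rewrite /bump !add1n binS natrD subSS !exprS.
    exact: pascal.
  by rewrite /bump /= !add1n !subSS subnn !binn exprS mulN1r !mulr1 mulNr addNr.
rewrite HT /surj_count /T big_ord_recr /= subnn expr0n mulr0 addr0 mulr_sumr.
apply: eq_bigr => i _.
have /(congr1 (fun k => k%:R : A)) : ((m.+1 - i) * 'C(m.+1, i) = m.+1 * 'C(m, i))%N.
  by rewrite -mul_bin_down.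
rewrite !natrM exprS => E.
transitivity
  ((-1) ^+ i * ((m.+1 - i)%:R * 'C(m.+1, i)%:R) * (m.+1 - i)%:R ^+ n : A).
  ring.
rewrite E; ring.
Qed.

Lemma surj_count_small (A : comNzRingType) n m : (n < m)%N -> surj_count A n m = 0.
Proof.
elim: n m => [|n IH] [|m] // nm; first by rewrite surj_count0.
by rewrite surj_countSS !IH ?addr0 ?mulr0 // ltnW.
Qed.

(** Expansion of a power in falling factorials, by the recurrence and
    (i + 1) C(w, i + 1) = (w - i) C(w, i). *)
Lemma expr_surj_count (A : comNzRingType) n w :
  w%:R ^+ n = \sum_(i < n.+1) surj_count A n i * 'C(w, i)%:R.
Proof.
elim: n => [|n IH]; first by rewrite big_ord1 surj_count0 bin0 mulr1 expr0.
rewrite big_ord_recl surj_countS0 mul0r add0r.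
have E (i : 'I_n.+1) : surj_count A n.+1 (lift ord0 i) * 'C(w, lift ord0 i)%:R =
    (i.+1%:R * 'C(w, i.+1)%:R) * surj_count A n i +
    i.+1%:R * surj_count A n i.+1 * 'C(w, i.+1)%:R.
  by rewrite lift0 surj_countSS; ring.
rewrite (eq_bigr _ (fun i _ => E i)) big_split /=.
rewrite [X in _ + X](_ : _ =
  \sum_(i < n.+1) i%:R * surj_count A n i * 'C(w, i)%:R); last first.
  rewrite big_ord_recr /= surj_count_small // big_ord_recl /=.
  by rewrite !(mulr0, mul0r, addr0, add0r).
rewrite -big_split exprS IH mulr_sumr; apply: eq_bigr => i _ /=.
have [iw|wi] := leqP i w; last by rewrite !bin_small ?(leqW wi) // !mulr0 mul0r addr0.
by rewrite -natrM mul_bin_left natrM natrB //; ring.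
Qed.

(** A finite difference of order N kills a polynomial of degree below N: on
    the monomials it is, up to sign, a vanishing surjection number. *)
Lemma alternating_sum_horner (A : comNzRingType) (p : {poly A}) N : (size p <= N)%N ->
  \sum_(k < N.+1) (-1) ^+ k * 'C(N, k)%:R * p.[- (N - k)%:R] = 0.
Proof.
move=> sp.
under eq_bigr do rewrite (horner_coef_wide _ sp) mulr_sumr.
rewrite exchange_big big1 // => i _ /=.
transitivity (p`_i * (-1) ^+ i * surj_count A i N); last first.
  by rewrite surj_count_small ?mulr0.
rewrite mulr_sumr; apply: eq_bigr => k _; rewrite [(- (N - k)%:R) ^+ i]exprNn; ring.
Qed.

(** * Eulerian polynomials as constants of a difference equation *)

(** The coefficients in reverse order: for n > 0 this is X times the usual
    Eulerian polynomial, by the symmetry of the Eulerian numbers. *)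
Definition eulerian_poly (A : comNzRingType) (n : nat) (x : A) : A :=
  \sum_(j < n.+1) (eulerian n (n - j))%:~R * x ^+ j.

Lemma eulerian_intr (A : comNzRingType) n m :
  (eulerian n m)%:~R =
  \sum_(k < m.+1) (-1) ^+ k * 'C(n.+1, k)%:R * ((m - k).+1)%:R ^+ n :> A.
Proof.
rewrite /eulerian rmorph_sum; apply: eq_bigr => k _.
by rewrite !rmorphM !rmorphXn rmorphN rmorph1 /= !rmorph_nat.
Qed.

Lemma difference_telescope (A : comNzRingType) (p : {poly A}) (x : A) n m :
  (forall y, x * p.[y + 1] - p.[y] = y ^+ n) ->
  x ^+ m * p.[0] = p.[- m%:R] + \sum_(j < m) x ^+ j * (- (m - j)%:R) ^+ n.
Proof.
move=> step; elim: m => [|m IH]; first by rewrite big_ord0 expr0 mul1r oppr0 addr0.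
rewrite exprS -mulrA IH mulrDr big_ord_recl expr0 mul1r subn0 addrA; congr (_ + _).
  have := step (- m.+1%:R); rewrite -addn1 natrD opprD addrNK => <-.
  by rewrite addrC subrK.
rewrite mulr_sumr; apply: eq_bigr => j _; rewrite lift0 subSS exprS; ring.
Qed.

(** Expanding (x - 1)^(n+1) leaves the multiples of x^(n+1-k) p(0).  The
    telescoped values p(-(n+1-k)) cancel, being a finite difference of order
    n + 1, and the coefficient of x^j in the remaining double sum is the
    explicit alternating sum defining the Eulerian number. *)
Lemma eulerian_poly_difference (A : comNzRingType) (p : {poly A}) (x : A) n :
  (size p <= n.+1)%N -> (forall y, x * p.[y + 1] - p.[y] = y ^+ n) ->
  (x - 1) ^+ n.+1 * p.[0] = (-1) ^+ n * eulerian_poly n x.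
Proof.
move=> sp step; rewrite exprBn mulr_suml.
transitivity (\sum_(k < n.+2) (-1) ^+ k * 'C(n.+1, k)%:R * p.[- (n.+1 - k)%:R] +
   \sum_(k < n.+2) (-1) ^+ k * 'C(n.+1, k)%:R *
      \sum_(j < n.+1 - k) x ^+ j * (- (n.+1 - k - j)%:R) ^+ n).
  rewrite -big_split; apply: eq_bigr => k _ /=.
  by rewrite -mulrDr -difference_telescope // expr1n mulr1 -mulr_natr; ring.
rewrite alternating_sum_horner // add0r big_ord_recr /= subnn big_ord0 mulr0 addr0.
rewrite /eulerian_poly mulr_sumr.
under [RHS]eq_bigr do rewrite eulerian_intr mulr_suml mulr_sumr.
under eq_bigr => k _ do rewrite mulr_sumr (big_ord_widen_cond n.+1 xpredT
  (fun j => (-1) ^+ k * 'C(n.+1, k)%:R *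
            (x ^+ j * (- (n.+1 - k - j)%:R) ^+ n))) ?leq_subr //=.
under [RHS]eq_bigr => j _ do rewrite (big_ord_widen_cond n.+1 xpredT
  (fun k => (-1) ^+ n * ((-1) ^+ k * 'C(n.+1, k)%:R *
            (n - j - k).+1%:R ^+ n * x ^+ j))) ?ltnS ?leq_subr //=.
(* Both triangular sums run over the pairs with j + k <= n. *)
rewrite (exchange_big_dep xpredT) //=; apply: eq_bigr => j _; apply: eq_big => k.
  by have := ltn_ord j; have := ltn_ord k; lia.
move=> kj; rewrite [(- _%:R) ^+ n]exprNn.
rewrite (_ : n.+1 - k - j = (n - j - k).+1)%N; last by lia.
ring.
Qed.

(** * Solving the difference equation by a moment functional *)

(** In the n-th equation c n occurs with coefficient x - 1, so the equations
    determine the moments one after the other. *)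
Lemma umbral_moments_exist (F : fieldType) (x : F) (N : nat) : x != 1 ->
  exists c : nat -> F, forall n, (n < N)%N ->
    x * (\sum_(i < n.+1) 'C(n, i)%:R * c i) - c n = (n == 0)%:R.
Proof.
rewrite -subr_eq0 => x1; elim: N => [|N [c cP]]; first by exists (fun=> 0).
pose v := ((N == 0)%:R - x * \sum_(i < N) 'C(N, i)%:R * c i) / (x - 1).
pose c' i := if i == N then v else c i.
have c'lt i : (i < N)%N -> c' i = c i by rewrite /c'; case: eqP => // ->; rewrite ltnn.
exists c' => n; rewrite ltnS leq_eqVlt => /predU1P[->|ltnN]; last first.
  rewrite -(cP n ltnN) (c'lt n ltnN); congr (x * _ - _); apply: eq_bigr => i _.
  by rewrite c'lt // (leq_trans (ltn_ord i)).
rewrite big_ord_recr /= binn mul1r.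
under eq_bigr => i _ do rewrite c'lt //.
by rewrite /c' eqxx /v; field.
Qed.

(** The functional with moments c, on polynomials of size at most N; summing
    over a fixed range instead of size p makes linearity a termwise fact. *)
Definition umbral (A : comNzRingType) (c : nat -> A) (N : nat) (p : {poly A}) : A :=
  \sum_(i < N) p`_i * c i.

Lemma umbral_is_linear (A : comNzRingType) (c : nat -> A) (N : nat) :
  linear_for *%R (umbral c N).
Proof.
move=> a p q; rewrite /umbral mulr_sumr -big_split; apply: eq_bigr => i _ /=.
by rewrite coefD coefZ; ring.
Qed.

HB.instance Definition _ (A : comNzRingType) c N :=
  GRing.isLinear.Build A {poly A} A *%R (umbral c N) (@umbral_is_linear A c N).

Lemma umbralXn (A : comNzRingType) (c : nat -> A) (N n : nat) :
  (n < N)%N -> umbral c N 'X^n = c n.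
Proof.
move=> nN; rewrite /umbral (bigD1 (Ordinal nN)) //= coefXn eqxx mul1r big1 ?addr0 // => i.
by rewrite -val_eqE /= coefXn => /negPf->; rewrite mul0r.
Qed.

Lemma umbralXaddCn (A : comNzRingType) (c : nat -> A) (N n : nat) (a w : A) :
  (n < N)%N ->
  umbral c N ((a *: 'X + w%:P) ^+ n) =
  (\sum_(i < n.+1) ('C(n, i)%:R * a ^+ i * c i) *: 'X^(n - i)).[w].
Proof.
move=> nN; rewrite addrC exprDn linear_sum horner_sum; apply: eq_bigr => i _.
rewrite !hornerE exprZn -mulr_natr -polyC_exp -scalerAr mulr_natr.
rewrite -scaler_nat !linearZ /= mul_polyC linearZ /= umbralXn; first by ring.
by rewrite (leq_trans (ltn_ord i)).
Qed.

(** By linearity it suffices to treat X^n, where the equation is the recursion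
    of the moments. *)
Lemma umbral_shift (A : comNzRingType) (x : A) (c : nat -> A) (N : nat) (p : {poly A}) :
  (forall n, (n < N)%N ->
    x * (\sum_(i < n.+1) 'C(n, i)%:R * c i) - c n = (n == 0)%:R) ->
  (size p <= N)%N ->
  x * umbral c N (p \Po ('X + 1)) - umbral c N p = p.[0].
Proof.
move=> cP sp; rewrite (horner_coef_wide _ sp).
have {1}-> : p \Po ('X + 1) = \sum_(i < N) p`_i *: ('X + 1) ^+ i.
  rewrite comp_polyE (big_ord_widen N (fun i => p`_i *: ('X + 1) ^+ i)) // big_mkcond.
  apply: eq_bigr => i _; case: ltnP => // ip.
  by rewrite nth_default // scale0r.
rewrite linear_sum mulr_sumr [umbral c N p]/umbral -sumrB; apply: eq_bigr => i _.
rewrite linearZ /= expr0n -(cP i (ltn_ord i)).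
have := @umbralXaddCn A c N i 1 1 (ltn_ord i); rewrite scale1r => ->.
rewrite horner_sum.
under eq_bigr do rewrite !hornerE !expr1n !mulr1.
ring.
Qed.

(** The n-th moment of the functional, formally minus the sum of l^n x^l over
    all l >= 0. *)
Definition eulerian_const (F : fieldType) (x : F) (n : nat) : F :=
  (-1) ^+ n * eulerian_poly n x / (x - 1) ^+ n.+1.

(** The expansion of L((y + a X)^n) as a polynomial in y, when the moments of
    L are the Eulerian constants of x. *)
Definition antidiff (F : fieldType) (a x : F) (n : nat) : {poly F} :=
  \sum_(i < n.+1) ('C(n, i)%:R * a ^+ i * eulerian_const x i) *: 'X^(n - i).

Lemma size_antidiff (F : fieldType) (a x : F) n : (size (antidiff a x n) <= n.+1)%N.
Proof.
apply: (leq_trans (size_sum _ _ _)); apply/bigmax_leqP => i _.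
by rewrite (leq_trans (size_scale_leq _ _)) // size_polyXn ltnS leq_subr.
Qed.

(** Shifting y by a amounts to replacing X by X + 1 in L((y + a X)^n), so the
    equation is that of the functional.  This first holds for the moments given
    by the recursion; for a = 1 it shows that those are the Eulerian
    constants. *)
Lemma antidiffP (F : fieldType) (a x w : F) n : x != 1 ->
  x * (antidiff a x n).[w + a] - (antidiff a x n).[w] = w ^+ n.
Proof.
move=> x1; have [c cP] := umbral_moments_exist n.+1 x1.
pose G m b := \sum_(i < m.+1) ('C(m, i)%:R * b ^+ i * c i) *: 'X^(m - i) : {poly F}.
have GP m b y : (m < n.+1)%N -> x * (G m b).[y + b] - (G m b).[y] = y ^+ m.
  move=> mn; rewrite -!(umbralXaddCn _ _ _ mn).
  have := @umbral_shift F x c n.+1 ((b *: 'X + y%:P) ^+ m) cP.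
  rewrite !hornerE ?mulr0 ?add0r => <-.
    congr (x * umbral _ _ _ - _).
    by rewrite rmorphXn /= comp_polyD comp_polyZ comp_polyX comp_polyC scalerDr
      alg_polyC [(y + b)%:P]polyCD [y%:P + _]addrC addrA.
  apply: (leq_trans (size_poly_exp_leq _ _)).
  apply: (leq_trans _ mn); rewrite ltnS.
  have : (size (b *: 'X + y%:P : {poly F})%R <= 2)%N.
    apply: (leq_trans (size_polyD _ _)).
    rewrite geq_max (leq_trans (size_scale_leq _ _)) ?size_polyX //.
    by rewrite (leq_trans (size_polyC_leq1 _)).
  by move=> s2; rewrite -[leqRHS]mul1n leq_mul2r -subn1 leq_subLR s2 orbT.
(* At step 1 the value at 0 of the solution is its last coefficient, c m. *)
have cE m : (m < n.+1)%N -> c m = eulerian_const x m.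
  move=> mn; apply: (@mulfI _ ((x - 1) ^+ m.+1)); first by rewrite expf_neq0 ?subr_eq0.
  rewrite /eulerian_const mulrC [RHS]mulrC divfK ?expf_neq0 ?subr_eq0 // mulrC.
  have sG : (size (G m 1%R) <= m.+1)%N.
    apply: (leq_trans (size_sum _ _ _)); apply/bigmax_leqP => i _.
    by rewrite (leq_trans (size_scale_leq _ _)) // size_polyXn ltnS leq_subr.
  rewrite -(eulerian_poly_difference sG) => [|y]; last exact: GP.
  congr (_ * _); rewrite horner_sum big_ord_recr /= subnn binn expr1n !mul1r.
  rewrite !hornerE big1 ?add0r // => i _.
  by rewrite !hornerE expr0n subn_eq0 leqNgt ltn_ord mulr0.
have -> : antidiff a x n = G n a.
  by apply: eq_bigr => i _; rewrite cE // ltn_ord.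
exact: GP.
Qed.

(** Shift the argument of every summand by y.  The resulting polynomial h in y
    satisfies x h(y + 1) - h(y) = x^a g(y + a) - g(y) = y^n by telescoping, so
    its value at 0 is the Eulerian constant of x. *)
Lemma sum_antidiff (F : fieldType) (a : nat) (x : F) n : x ^+ a != 1 ->
  \sum_(s < a) x ^+ s * (antidiff a%:R (x ^+ a) n).[s%:R] = eulerian_const x n.
Proof.
move=> xa1; have x1 : x != 1 by apply: contraNneq xa1 => ->; rewrite expr1n.
set g := antidiff _ _ _.
pose h := \sum_(s < a) x ^+ s *: (g \Po ('X + (s%:R)%:P)).
have hE y : h.[y] = \sum_(s < a) x ^+ s * g.[y + s%:R].
  by rewrite horner_sum; apply: eq_bigr => s _; rewrite hornerZ horner_comp !hornerE.
apply: (@mulfI _ ((x - 1) ^+ n.+1)); first by rewrite expf_neq0 ?subr_eq0.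
rewrite /eulerian_const mulrC [RHS]mulrC divfK ?expf_neq0 ?subr_eq0 // mulrC.
rewrite -(@eulerian_poly_difference _ h) => [| |y].
- by rewrite hE; under [in RHS]eq_bigr do rewrite add0r.
- apply: (leq_trans (size_sum _ _ _)); apply/bigmax_leqP => s _.
  rewrite (leq_trans (size_scale_leq _ _)) // size_comp_poly2 ?size_XaddC //.
  exact: size_antidiff.
rewrite !hE -(antidiffP a%:R y n xa1) -/g mulr_sumr -sumrB.
rewrite -[X in _ - X](_ : x ^+ 0 * g.[y + 0%:R] = _); last by rewrite expr0 addr0 mul1r.
rewrite -(@telescope_sumr _ 0 a (fun s => x ^+ s * g.[y + s%:R])) // big_mkord.
apply: eq_bigr => s _; rewrite exprS mulrA; congr (_ * g.[_] - _).
by rewrite -addrA -natr1 [1 + _]addrC.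
Qed.

(** * Gaps of the semigroup of an arithmetic progression *)

Section ProgressionSemigroup.
Local Open Scope nat_scope.

Lemma progression_semigroupP (m a d n : nat) :
  (exists c : 'I_m.+1 -> nat, n = \sum_i c i * (a + i * d)) <->
  exists s j, j <= s * m /\ n = s * a + j * d.
Proof.
split=> [[c ->]|[s [j [jsm ->]]]].
  exists (\sum_i c i), (\sum_i c i * i); split.
    by rewrite big_distrl leq_sum // => i _; rewrite leq_mul2l -ltnS ltn_ord orbT.
  by rewrite !big_distrl -big_split; apply: eq_bigr => i _; rewrite mulnDr mulnA.
(* Use one more generator, with the largest admissible multiple of d. *)
elim: s j jsm => [|s IH] j jsm.
  by exists (fun=> 0); rewrite big1 //; move: jsm; rewrite leqn0 => /eqP->.
have [|c cE] := IH (j - minn j m); first by lia.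
have jm : minn j m < m.+1 by rewrite ltnS geq_minr.
exists (fun i => c i + (i == Ordinal jm)).
under eq_bigr do rewrite mulnDl.
rewrite big_split -cE /= (bigD1 (Ordinal jm)) //= eqxx mul1n big1 => [|i /negPf->//].
by rewrite addn0 addnACA -mulSnr -mulnDl subnK ?geq_minl.
Qed.

(** For a coprime to d and j < a, the least element of the semigroup congruent
    to j d modulo a; the quotient is the ceiling of j / m, the least number of
    generators whose multiples of d can add up to j d. *)
Definition apery (m a d j : nat) : nat := (j + m.-1) %/ m * a + j * d.

Lemma ceil_divn_leq m j s : 0 < m -> ((j + m.-1) %/ m <= s) = (j <= s * m).
Proof.
move=> m0; rewrite -ltnS ltn_divLR // mulSn; lia.
Qed.

Lemma apery_mod m a d j : apery m a d j = j * d %[mod a].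
Proof. by rewrite /apery modnMDl. Qed.

Lemma apery_inj_mod m a d (i j : 'I_a) : coprime a d ->
  apery m a d i = apery m a d j %[mod a] -> i = j.
Proof.
move=> ad /eqP; rewrite !apery_mod => E; apply: val_inj => /=.
wlog ij : i j E / i <= j => [W|].
  by have /orP[/W->//|/W<-//] := leq_total i j; rewrite eq_sym.
move: E; rewrite eq_sym eqn_mod_dvd ?leq_mul2r ?ij ?orbT // -mulnBl Gauss_dvdl //.
by move=> /dvdn_leq; have := ltn_ord j; lia.
Qed.

(** Every n is congruent to exactly one apery element w_j.  From w_j on, n is
    w_j plus copies of a; conversely n = s a + i d forces j <= i, hence at
    least ceil(j / m) generators and n >= w_j. *)
Lemma progression_gapP (m a d n : nat) : 0 < m -> coprime a d -> 0 < a ->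
  (~ exists c : 'I_m.+1 -> nat, n = \sum_i c i * (a + i * d)) <->
  [exists j : 'I_a, (n == apery m a d j %[mod a]) && (n < apery m a d j)].
Proof.
move=> m0 ad a0; rewrite progression_semigroupP.
split=> [gap|/existsP[j /andP[nj ltnj]] [s [i [ism nE]]]].
  pose f (j : 'I_a) := Ordinal (ltn_pmod (apery m a d j) a0).
  have f_inj : injective f.
    by move=> i j /(congr1 val) /=; exact: apery_inj_mod.
  have [g _ fK] := injF_bij f_inj.
  pose j := g (Ordinal (ltn_pmod n a0)).
  have jE : n = apery m a d j %[mod a] by rewrite -[RHS]/(val (f j)) fK.
  apply/existsP; exists j; rewrite jE eqxx /= ltnNge; apply/negP => len.
  apply: gap; move/eqP: jE; rewrite eqn_mod_dvd // => /dvdnP[l nE].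
  exists (l + (j + m.-1) %/ m), j; split.
    by rewrite mulnDl (leq_trans _ (leq_addl _ _)) // -ceil_divn_leq.
  by rewrite -(subnK len) nE /apery mulnDl addnA.
have ji : i %% a = j.
  move: nj; rewrite nE modnMDl apery_mod => nj.
  have /(@apery_inj_mod m a d (Ordinal (ltn_pmod i a0)) j ad)/(congr1 val) // :
    apery m a d (i %% a) = apery m a d j %[mod a].
  by rewrite !apery_mod modnMml (eqP nj).
have leji : j <= i by rewrite -ji leq_mod.
move: ltnj; rewrite ltnNge => /negP; apply; rewrite nE /apery.
by rewrite leq_add // leq_mul2r ?leji ?orbT // ceil_divn_leq // (leq_trans leji) ?orbT.
Qed.

End ProgressionSemigroup.

(** * Summation over the gaps *)

Lemma sum_residue_telescope (V : zmodType) (F : nat -> V) (a w : nat) : (0 < a)%N ->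
  \sum_(0 <= n < w | n == w %[mod a]) (F (n + a)%N - F n) = F w - F (w %% a)%N.
Proof.
move=> a0; rewrite [in LHS](divn_eq w a) [in X in F X - _](divn_eq w a) modnMDl modn_mod.
have := ltn_pmod w a0; move: (w %% a)%N (w %/ a)%N => s c sa {w}.
elim: c => [|c IH].
  rewrite mul0n add0n subrr big_nat_cond big1 // => n /andP[/andP[_ ns]].
  by rewrite modn_small ?(ltn_trans ns) // (ltn_eqF ns).
rewrite (big_cat_nat (n := c * a + s)) //=; last by rewrite leq_add2r leq_mul2r leqnSn orbT.
rewrite IH (_ : c.+1 * a + s = c * a + s + a)%N; last by rewrite mulSn; lia.
rewrite big_ltn_cond; last by lia.
rewrite modnMDl modn_small // eqxx big_nat_cond big1 ?addr0 => [|n].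
  by rewrite addrC addrA subrK.
move=> /andP[/andP[lo hi]] /eqP E.
have : (c * a + s == n %[mod a])%N by rewrite modnMDl E modn_small.
rewrite eq_sym eqn_mod_dvd ?(ltnW lo) // => /dvdn_leq; lia.
Qed.

(** Each class telescopes from its least residue up to its representative, and
    the least residues are all of 0, ..., a - 1. *)
Lemma sum_below_representatives (V : zmodType) (F : nat -> V) (a : nat)
    (w : 'I_a -> nat) (B : nat) :
  (0 < a)%N ->
  (forall i j, w i = w j %[mod a] -> i = j) ->
  (forall j, w j <= B)%N ->
  \sum_(0 <= n < B | [exists j, (n == w j %[mod a]) && (n < w j)%N]) (F (n + a)%N - F n)
  = \sum_j F (w j) - \sum_(s < a) F s.
Proof.
move=> a0 w_inj wB.
transitivity (\sum_(0 <= n < B)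
  \sum_(j | (n == w j %[mod a]) && (n < w j)%N) (F (n + a)%N - F n)).
  rewrite big_mkcond; apply: eq_bigr => n _; case: existsP => [[j jP]|noj].
    rewrite (big_pred1 j) // => i; apply/idP/eqP => [iP|->//].
    apply: w_inj; case/andP: iP => /eqP<- _; case/andP: jP => /eqP<- //.
  by rewrite big_pred0 // => j; apply/negP => jP; apply: noj; exists j.
rewrite (exchange_big_dep xpredT) //=.
pose f (j : 'I_a) := Ordinal (ltn_pmod (w j) a0).
have f_inj : injective f by move=> i j /(congr1 val); apply: w_inj.
rewrite [X in _ = _ - X](reindex_inj f_inj) -sumrB; apply: eq_bigr => j _ /=.
rewrite -sum_residue_telescope // (@big_nat_widen _ _ _ 0%N (w j) B) //.
Qed.

(** The indices j = t m + s + 1 with 0 <= s < m share the ceiling t + 1, so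
    each block is a geometric progression of ratio x^d; the index 0 gives the
    summand 1, and the last, incomplete block has length r. *)
Lemma sum_expr_apery (F : fieldType) (x : F) (m a d q r : nat) :
  (0 < m)%N -> (a = (q * m + r).+1)%N -> (r <= m)%N -> x ^+ d != 1 ->
  \sum_(j < a) x ^+ apery m a d j =
  1 + x ^+ d * (x ^+ (a + m * d) - x ^+ a) / (x ^+ d - 1)
      * (\sum_(t < q) x ^+ (t * (a + m * d)))
  + x ^+ (q * (a + m * d) + a + d) * (x ^+ (r * d) - 1) / (x ^+ d - 1).
Proof.
rewrite -subr_eq0 => m0 aE rm xd.
have geom l : \sum_(s < l) x ^+ (s * d) = (x ^+ (l * d) - 1) / (x ^+ d - 1).
  apply: (mulfI xd); rewrite [RHS]mulrC divfK // mulnC exprM [RHS]subrX1.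
  by congr (_ * _); apply: eq_bigr => s _; rewrite mulnC exprM.
have row t l : (l <= m)%N -> \sum_(s < l) x ^+ apery m a d (t * m + s).+1 =
    x ^+ (t * (a + m * d) + a + d) * ((x ^+ (l * d) - 1) / (x ^+ d - 1)).
  move=> lm; rewrite -geom mulr_sumr; apply: eq_bigr => s _.
  rewrite -exprD /apery addSnnS prednK // -addnA divnMDl // divnDr ?divnn // m0.
  rewrite divn_small ?(leq_trans (ltn_ord s)) //; congr (_ ^+ _).
  by rewrite /=; lia.
transitivity (\sum_(j < (q * m + r).+1) x ^+ apery m a d j); first by rewrite -aE.
rewrite big_ord_recl [X in x ^+ X + _]/apery div.divn_small ?prednK //.
rewrite mul0n expr0 -addrA; congr (_ + _).
rewrite -(big_mkord xpredT (fun j => x ^+ apery m a d j.+1)).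
rewrite (big_cat_nat (n := q * m)) //= ?leq_addr //; congr (_ + _).
  rewrite big_nat_mul big_mkord mulr_sumr; apply: eq_bigr => t _.
  rewrite mulSnr -{1}[(t * m)%N]add0n [(t * m + m)%N]addnC big_addn addnK big_mkord.
  under eq_bigr do rewrite addnC.
  by rewrite row // !exprD !mulrBr; ring.
rewrite -{1}[(q * m)%N]add0n [(q * m + r)%N]addnC big_addn addnK big_mkord.
under eq_bigr do rewrite addnC.
by rewrite row // mulrA.
Qed.

(** * Iterated derivatives of polynomials *)

Section PolynomialDerivatives.
Local Open Scope classical_set_scope.

(** The conclusion is again about a neighbourhood, since the next derivative at
    a point needs the present one around it. *)
Lemma near_eq_derive1n (K : numFieldType) (f g : K -> K^o) (n : nat) (x : K) :
  (\forall y \near x, f y = g y) ->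
  \forall y \near x, derive1n n f y = derive1n n g y.
Proof.
move=> fg; elim: n => [|n IH] //.
have {}IH := nbhs_interior IH.
apply: filterS IH => y yy; rewrite !derive1nS !derive1E.
exact: near_eq_derive.
Qed.

Lemma is_derive_horner (K : numFieldType) (p : {poly K}) (x : K) :
  is_derive x (1:K) (horner p : K -> K^o) p^`().[x].
Proof.
elim/poly_ind: p => [|p c ih].
  have -> : horner (0 : {poly K}) = cst 0 by apply/funext => y; rewrite horner0.
  by rewrite deriv0 horner0; apply: is_derive_cst.
have -> : (horner (p * 'X + c%:P) : K -> K^o) = (horner p : K -> K^o) * id + cst c.
  by apply/funext => y; rewrite /= !hornerE.
apply: is_derive_eq.
rewrite derivMXaddC /= !hornerE.
by rewrite /GRing.scale /= mulr1 [x * _]mulrC.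
Qed.

Lemma derive1n_horner (K : numFieldType) (p : {poly K}) (n : nat) :
  derive1n n (horner p : K -> K^o) = horner p^`(n).
Proof.
elim: n => [|n IH]; first by rewrite derive1n0 derivn0.
rewrite derive1nS IH derivnS; apply/funext => x; rewrite derive1E.
have ? := @is_derive_horner K (derivn n p) x; exact: derive_val.
Qed.

Lemma near_expr_neq1 (K : numFieldType) (n : nat) (x : K) :
  x ^+ n != 1 -> \forall y \near x, y ^+ n != 1.
Proof.
rewrite -subr_eq0 => xn.
have [/derivable1_diffP/differentiable_continuous cx _] :=
  @is_derive_horner K ('X^n - 1) x.
have := @cvgr_neq0 _ _ _ _ _ _ _ cx; rewrite !hornerE => /(_ _ xn).
by apply: filterS => y; rewrite !hornerE subr_eq0.
Qed.

End PolynomialDerivatives.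

(** * The power sum over the gaps *)

Lemma stirling2_factM (F : numFieldType) (n i : nat) :
  ratr (stirling2 n i) * i`!%:R = surj_count F n i.
Proof.
have i0 : (i`!%:R : F) != 0 by rewrite pnatr_eq0 -lt0n fact_gt0.
rewrite /stirling2 rmorphM fmorphV rmorph_nat rmorph_sum mulrC mulVKf //.
apply: eq_bigr => j _.
by rewrite !rmorphM !rmorphXn rmorphN rmorph1 /= !rmorph_nat.
Qed.

(** The Stirling numbers rewrite the operator (x d/dx)^n, which multiplies X^w
    by w^n, in terms of the operators x^i d^i/dx^i. *)
Lemma stirling2_derivn_sum (F : numFieldType) (I : finType) (w : I -> nat)
    (n : nat) (x : F) :
  \sum_(i < n.+1) ratr (stirling2 n i) * x ^+ i * (\sum_j 'X^(w j))^`(i).[x] =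
  \sum_j x ^+ w j * (w j)%:R ^+ n.
Proof.
under eq_bigr => i _ do rewrite linear_sum horner_sum mulr_sumr.
rewrite exchange_big; apply: eq_bigr => j _ /=.
rewrite (expr_surj_count _ n (w j)) mulr_sumr; apply: eq_bigr => i _.
rewrite derivnXn hornerMn hornerXn -bin_ffact -stirling2_factM -mulr_natr natrM.
have [iw|wi] := leqP i (w j); last by rewrite bin_small // mul0r !mulr0.
by rewrite -[in x ^+ w j](subnKC iw) exprD; ring.
Qed.

Lemma fsum_NR_progression (V : zmodType) (f : nat -> V) (m a d : nat) :
  (0 < m)%N -> (0 < a)%N -> coprime a d ->
  \sum_(n \in NR (fun i : 'I_m.+1 => (a + i * d)%N)) f n =
  \sum_(0 <= n < \max_(j < a) apery m a d j |
     [exists j : 'I_a, (n == apery m a d j %[mod a]) && (n < apery m a d j)%N]) f n.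
Proof.
move=> m0 a0 ad; set B := \max_(j < a) _.
pose gap n := [exists j : 'I_a, (n == apery m a d j %[mod a]) && (n < apery m a d j)%N].
have -> : NR (fun i : 'I_m.+1 => (a + i * d)%N) =
    [set` [seq n <- index_iota 0 B | gap n]]%classic.
  apply/seteqP; split=> n /=; rewrite mem_filter mem_index_iota /=.
    case=> _ /(progression_gapP n m0 ad a0) ng; rewrite /gap ng /=.
    have /existsP[j /andP[_ nj]] := ng.
    by rewrite (leq_trans nj) // /B (bigop.bigmax_sup j).
  case/andP => /(progression_gapP n m0 ad a0) ng _; split=> //.
  (* A gap is positive because 0 is the empty combination. *)
  rewrite lt0n; apply/eqP => n0; apply: ng; exists (fun=> 0%N).
  by rewrite n0 big1.
by rewrite -fsbig_seq ?filter_uniq ?iota_uniq // big_filter.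
Qed.

Theorem theorem3 (R : realType) (a d k q r ak : nat) (lambda : R[i])
  (ha : (0 < a)%N) (hd : (0 < d)%N) (had : gcdn a d = 1%N)
  (hk2 : (2 <= k)%N) (hka : (k <= a)%N)
  (hqr : (a - 1 = q * (k - 1) + r)%N) (hr : (r < k - 1)%N)
  (hak : ak = (a + (k - 1) * d)%N)
  (hl0 : lambda <> 0) (hla : lambda ^+ a <> 1) (hld : lambda ^+ d <> 1)
  (mu : nat) (hmu : (0 < mu)%N) :
  power_sum (fun i : 'I_k => (a + i * d)%N) lambda mu =
    \sum_(n < mu.+1)
      (- a%:R) ^+ n / (lambda ^+ a - 1) ^+ n.+1 * 'C(mu, n)%:R
      * (\sum_(j < n.+1) (eulerian n (n - j))%:~R * lambda ^+ (j * a))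
      * (\sum_(i < (mu - n).+1)
           ratr (stirling2 (mu - n) i) * lambda ^+ i
           * cderiven i
               (fun x : R[i] =>
                  1
                  + x ^+ d * (x ^+ ak - x ^+ a) / (x ^+ d - 1)
                    * (\sum_(t < q) x ^+ (t * ak))
                  + x ^+ (q * ak + a + d) * (x ^+ (r * d) - 1) / (x ^+ d - 1))
               lambda)
    + (-1) ^+ mu.+1 / (lambda - 1) ^+ mu.+1
      * (\sum_(j < mu.+1) (eulerian mu (mu - j))%:~R * lambda ^+ j).
Proof.
case: k hk2 hka hqr hr hak => [//|m] m0 _.
rewrite (_ : m.+1 - 1 = m)%N ?subn1 // => aE rm -> {ak}.
rewrite ltnS in m0; move/eqP in hla; move/eqP in hld.
have aqr : (a = (q * m + r).+1)%N by rewrite -aE prednK.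
have ad : coprime a d by rewrite /coprime had.
set g := fun x : R[i] => 1 + _ + _.
pose P : {poly R[i]} := \sum_(j < a) 'X^(apery m a d j).
have gP i : cderiven i g lambda = P^`(i).[lambda].
  rewrite -derive1n_horner; apply: (nbhs_singleton (near_eq_derive1n i _)).
  apply: filterS (near_expr_neq1 hld) => y yd.
  rewrite horner_sum /g -(sum_expr_apery m0 aqr (ltnW rm) yd).
  by apply: eq_bigr => j _; rewrite hornerXn.
pose A := antidiff a%:R (lambda ^+ a) mu.
pose F n := lambda ^+ n * A.[n%:R].
have FP n : lambda ^+ n * n%:R ^+ mu = F (n + a)%N - F n.
  by rewrite -(antidiffP a%:R n%:R mu hla) -natrD /F exprD; ring.
rewrite /power_sum fsum_NR_progression //.
under eq_bigr do rewrite FP.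
rewrite sum_below_representatives //; first last.
- by move=> j; rewrite (bigop.bigmax_sup j).
- by move=> i j; apply: apery_inj_mod.
rewrite sum_antidiff //; congr (_ + _).
  under eq_bigr do rewrite /F horner_sum mulr_sumr.
  rewrite exchange_big; apply: eq_bigr => n _ /=.
  under [X in _ = _ * X]eq_bigr do rewrite gP.
  rewrite stirling2_derivn_sum mulr_sumr; apply: eq_bigr => j _.
  rewrite hornerZ hornerXn /eulerian_const /eulerian_poly [(- a%:R) ^+ n]exprNn.
  under [in RHS]eq_bigr do rewrite mulnC exprM.
  by ring.
by rewrite /eulerian_const /eulerian_poly [(-1) ^+ mu.+1]exprS; ring.
Qed.
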